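(* Let $\bm{A}\in\mathbb{R}^{n\times m}$ be a partially known matrix with set of known entries $\Omega\subset\{1,\dots,n\}\times\{1,\dots,m\}$, let $\bm{B}\in\mathbb{R}^{m\times p}$ be a known feature matrix, let $\gamma>0$ and $1\le k\le p$. The regularized interpretable matrix completion problem $$\min_{\bm{U}\in\mathbb{R}^{n\times p}}\ \min_{\bm{s}\in S_k^p}\ \frac{1}{nm}\Big(\sum_{(i,j)\in\Omega}(X_{ij}-A_{ij})^2+\frac1\gamma\|\bm{U}\|_2^2\Big)\quad\text{subject to}\quad \bm{X}=\bm{U}\bm{S}\bm{B}^T,\qquad \bm{S}=\mathrm{Diag}(s_1,\dots,s_p),$$ can be reformulated as the binary convex optimization problem $$\min_{\bm{s}\in S_k^p}\ c(\bm{s})=\frac{1}{nm}\sum_{i=1}^n\overline{\bm{a}}_i\Big(\bm{I}_m+\gamma\,\bm{W}_i\Big(\sum_{j=1}^p s_j\bm{K}_j\Big)\bm{W}_i\Big)^{-1}\overline{\bm{a}}_i^T .$$ That is, the two problems have the same optimal value, a vector $\bm{s}\in S_k^p$ is the $\bm{s}$-part of an optimal solution of the first problem if and only if it is optimal for the second, and $c$ (defined by the displayed formula for $\bm{s}\in[0,\infty)^p$) is a convex function of $\bm{s}$.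
   Context: $S_k^p=\{\bm{s}\in\{0,1\}^p:\sum_{i=1}^p s_i=k\}$. $\|\bm{U}\|_2^2$ denotes the sum of the squared entries of $\bm{U}$ (equivalently the sum of the squared Euclidean norms of its rows). For $i=1,\dots,n$, $\bm{W}_i\in\mathbb{R}^{m\times m}$ is the diagonal matrix with $(\bm{W}_i)_{jj}=1$ if $(i,j)\in\Omega$ and $0$ otherwise; $\bm{a}_i\in\mathbb{R}^{1\times m}$ is the $i$th row of $\bm{A}$ with unknown entries set to $0$; $\overline{\bm{a}}_i=\bm{a}_i\bm{W}_i$. For $j=1,\dots,p$, $\bm{b}^j\in\mathbb{R}^{m\times1}$ is the $j$th column of $\bm{B}$ and $\bm{K}_j=\bm{b}^j(\bm{b}^j)^T\in\mathbb{R}^{m\times m}$. *)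

(* Defs.v *)
From HB Require Import structures.
From mathcomp Require Import all_boot all_order all_algebra.
From mathcomp Require Import boolp classical_sets reals interval_inference convex.

Set Implicit Arguments.
Unset Strict Implicit.
Unset Printing Implicit Defensive.

Import Order.TTheory GRing.Theory Num.Theory.

Local Open Scope classical_set_scope.
Local Open Scope ring_scope.

Definition is_minimizer (R : realType) (T : Type) (D : set T) (f : T -> R)
    (x : T) : Prop :=
  D x /\ (forall y, D y -> f x <= f y).

(* The minimum is required to be attained, so this is stronger than
   [inf (f @` D) = v]. *)
Definition is_min_value (R : realType) (T : Type) (D : set T) (f : T -> R)
    (v : R) : Prop :=
  exists2 x, is_minimizer D f x & f x = v.

(* Binary vectors are kept as real row vectors, so that the function [cost]
   below is the same function on the binary points and on the orthant. *)
Definition binary_vectors (R : realType) (p k : nat) : set 'rV[R]_p :=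
  [set s | (forall j, s 0 j = 0 \/ s 0 j = 1) /\ \sum_j s 0 j = k%:R].

Definition nonneg_orthant (R : realType) (p : nat) : set 'rV[R]_p :=
  [set s | forall j, 0 <= s 0 j].

Section Completion.
Variables (R : realType) (n m p : nat).
(* [A] is a total matrix, but its entries outside [Omega] are never used. *)
Variables (A : 'M[R]_(n, m)) (Omega : {set 'I_n * 'I_m}).
Variables (B : 'M[R]_(m, p)) (gamma : R).

Definition sq_norm (U : 'M[R]_(n, p)) : R := \sum_i \sum_j U i j ^+ 2.

(* Decision variables (U, s, X). *)
Definition imc_feasible (k : nat) :
    set ('M[R]_(n, p) * 'rV[R]_p * 'M[R]_(n, m)) :=
  [set z | let: (U, s, X) := z in
     binary_vectors k s /\ X = U *m diag_mx s *m B^T].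

Definition imc_objective (z : 'M[R]_(n, p) * 'rV[R]_p * 'M[R]_(n, m)) : R :=
  let: (U, s, X) := z in
  (n * m)%:R^-1 *
    (\sum_(e in Omega) (X e.1 e.2 - A e.1 e.2) ^+ 2 + gamma^-1 * sq_norm U).

Definition maskW (i : 'I_n) : 'M[R]_m :=
  diag_mx (\row_j (if (i, j) \in Omega then 1 else 0)).

Definition known_row (i : 'I_n) : 'rV[R]_m :=
  \row_j (if (i, j) \in Omega then A i j else 0).

Definition abar (i : 'I_n) : 'rV[R]_m := known_row i *m maskW i.

Definition featK (j : 'I_p) : 'M[R]_m := col j B *m (col j B)^T.

Definition cost_mx (s : 'rV[R]_p) (i : 'I_n) : 'M[R]_m :=
  1%:M + gamma *: (maskW i *m (\sum_j s 0 j *: featK j) *m maskW i).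

Definition cost (s : 'rV[R]_p) : R :=
  (n * m)%:R^-1 *
    \sum_i (abar i *m invmx (cost_mx s i) *m (abar i)^T) 0 0.

End Completion.

(* Main.v *)
(* For fixed [s], the problem splits over the rows of [U] into ridge
   regressions. Fix such a row, with [G = W_i B], [a = abar_i],
   [M = I + gamma G S G^T] and [w = a M^-1]. As [S^2 = S] for binary [s], with
   [r = a - u S G^T] and [g = w G S] one has
     [a M^-1 a^T = w M w^T = |w|^2 + gamma |g|^2] and
     [a M^-1 a^T = a w^T = r w^T + u g^T],
   so bounding the products by Young's inequality gives
   [a M^-1 a^T <= |r|^2 + |u|^2 / gamma], with equality at [u = gamma g], where
   [r = w]. Convexity holds because [a M^-1 a^T] is the maximum over [w] of
   [2 a w^T - w M w^T], which is affine in [s]. *)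
Require Import Defs.
From HB Require Import structures.
From mathcomp Require Import all_boot all_order all_algebra.
From mathcomp Require Import boolp classical_sets reals interval_inference convex.
From mathcomp Require Import ring lra.

Set Implicit Arguments.
Unset Strict Implicit.
Unset Printing Implicit Defensive.

Import Order.TTheory GRing.Theory Num.Theory.

Local Open Scope classical_set_scope.
Local Open Scope ring_scope.

(** * Ridge regression for a single row and its dual form *)

Section RidgeDuality.
Context {R : realFieldType}.

Definition dotr {n : nat} (u v : 'rV[R]_n) : R := (u *m v^T) 0 0.

Lemma dotrE n (u v : 'rV[R]_n) : dotr u v = \sum_j u 0 j * v 0 j.
Proof. by rewrite /dotr mxE; apply: eq_bigr => j _; rewrite mxE. Qed.

Lemma dotrC n (u v : 'rV[R]_n) : dotr u v = dotr v u.
Proof. by rewrite !dotrE; apply: eq_bigr => j _; rewrite mulrC. Qed.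

Lemma dotrDl n (u v w : 'rV[R]_n) : dotr (u + v) w = dotr u w + dotr v w.
Proof. by rewrite /dotr mulmxDl mxE. Qed.

Lemma dotrZl n c (u v : 'rV[R]_n) : dotr (c *: u) v = c * dotr u v.
Proof. by rewrite /dotr -scalemxAl mxE. Qed.

Lemma dotrNl n (u v : 'rV[R]_n) : dotr (- u) v = - dotr u v.
Proof. by rewrite /dotr mulNmx mxE. Qed.

Lemma dotrDr n (u v w : 'rV[R]_n) : dotr u (v + w) = dotr u v + dotr u w.
Proof. by rewrite dotrC dotrDl !(dotrC u). Qed.

Lemma dotrNr n (u v : 'rV[R]_n) : dotr u (- v) = - dotr u v.
Proof. by rewrite dotrC dotrNl dotrC. Qed.

Lemma dotr_mulmxl m n (u : 'rV[R]_m) (M : 'M_(m, n)) v :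
  dotr (u *m M) v = dotr u (v *m M^T).
Proof. by rewrite /dotr trmx_mul trmxK mulmxA. Qed.

Lemma dotr_sqr n (u : 'rV[R]_n) : dotr u u = \sum_j u 0 j ^+ 2.
Proof. by rewrite dotrE; apply: eq_bigr => j _; rewrite expr2. Qed.

Lemma dotr_ge0 n (u : 'rV[R]_n) : 0 <= dotr u u.
Proof. by rewrite dotr_sqr; apply: sumr_ge0 => j _; exact: sqr_ge0. Qed.

Lemma dotr_le0_eq0 n (u : 'rV[R]_n) : dotr u u <= 0 -> u = 0.
Proof.
move=> u_le0; have /eqP : dotr u u = 0 by apply/le_anti; rewrite u_le0 dotr_ge0.
rewrite dotr_sqr psumr_eq0 => [/allP u0|j _]; last exact: sqr_ge0.
apply/rowP => j; rewrite mxE; apply/eqP.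
by have := u0 j (mem_index_enum _); rewrite /= sqrf_eq0.
Qed.

(** Expand [0 <= |u - c v|^2] and divide by [c]. *)
Lemma dotr_young n c (u v : 'rV[R]_n) : 0 < c ->
  2 * dotr u v <= c^-1 * dotr u u + c * dotr v v.
Proof.
move=> c_gt0; have := dotr_ge0 (u - c *: v).
rewrite !(dotrDl, dotrDr, dotrNl, dotrNr, dotrZl) !(dotrC _ (c *: v)) !dotrZl.
rewrite (dotrC v u) => /(mulr_ge0 (ltW (eqbRL (invr_gt0 c) c_gt0))).
suff -> : c^-1 * (dotr u u - c * dotr u v + (- (c * dotr u v) - - (c * (c * dotr v v)))) =
   c^-1 * dotr u u + c * dotr v v - 2 * dotr u v by rewrite subr_ge0.
by field; rewrite gt_eqF.
Qed.

(** The matrix [M] of the overview; with [G = maskW i *m B] it equals [cost_mx s i]. *)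
Definition reg_gram {m p : nat} (gamma : R) (G : 'M[R]_(m, p)) (s : 'rV[R]_p) :
  'M[R]_m := 1%:M + gamma *: (G *m diag_mx s *m G^T).

Variables (m p : nat) (gamma : R) (G : 'M[R]_(m, p)).
Hypothesis gamma_gt0 : 0 < gamma.
Implicit Types (s : 'rV[R]_p) (a u v w : 'rV[R]_m).

Let M := reg_gram gamma G.

Lemma reg_gram_tr s : (M s)^T = M s.
Proof.
rewrite /M /reg_gram linearD /= trmx1 linearZ /= !trmx_mul trmxK tr_diag_mx.
by rewrite mulmxA.
Qed.

Lemma reg_gram_form s u v :
  dotr (u *m M s) v = dotr u v + gamma * dotr (u *m G *m diag_mx s) (v *m G).
Proof.
rewrite /M /reg_gram mulmxDr mulmx1 dotrDl -scalemxAr dotrZl.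
by rewrite !mulmxA [in LHS]dotr_mulmxl trmxK.
Qed.

Lemma dotr_diag_ge0 s (u : 'rV[R]_p) : (forall j, 0 <= s 0 j) ->
  0 <= dotr (u *m diag_mx s) u.
Proof.
move=> s_ge0; rewrite dotrE; apply: sumr_ge0 => j _.
by rewrite mul_mx_diag mxE mulrAC -expr2 mulr_ge0 ?sqr_ge0.
Qed.

Lemma reg_gram_ge s w : (forall j, 0 <= s 0 j) ->
  dotr w w <= dotr (w *m M s) w.
Proof.
move=> s_ge0; rewrite reg_gram_form lerDl.
by rewrite (mulr_ge0 (ltW gamma_gt0)) ?dotr_diag_ge0.
Qed.

(** The form of [M s] dominates the squared norm, so every row of its left kernel has squared norm
    at most 0. *)
Lemma reg_gram_unit s : (forall j, 0 <= s 0 j) -> M s \in unitmx.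
Proof.
move=> s_ge0; rewrite -row_free_unit -kermx_eq0; apply/eqP/row_matrixP => i.
rewrite row0; apply: dotr_le0_eq0; apply: (le_trans (reg_gram_ge _ s_ge0)).
by rewrite -row_mul mulmx_ker row0 /dotr mul0mx mxE.
Qed.

(* [a M^-1 a^T = max_w (2 a w^T - w M w^T)], attained at [w = a M^-1]. *)
Lemma reg_gram_dual_le s a w : (forall j, 0 <= s 0 j) ->
  2 * dotr a w - dotr (w *m M s) w <= dotr (a *m invmx (M s)) a.
Proof.
move=> s_ge0; have Mu := reg_gram_unit s_ge0; set v := a *m _.
have av : a = v *m M s by rewrite mulmxKV.
(* Completing the square: this quantity is exactly the gap between the two sides. *)
have : 0 <= dotr ((w - v) *m M s) (w - v).
  exact: le_trans (dotr_ge0 _) (reg_gram_ge _ s_ge0).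
rewrite mulmxBl -av !(dotrDl, dotrDr, dotrNl, dotrNr).
have -> : dotr (w *m M s) v = dotr a w by rewrite dotr_mulmxl reg_gram_tr -av dotrC.
by rewrite (dotrC v a); lra.
Qed.

Lemma reg_gram_dual_eq s a (w := a *m invmx (M s)) : (forall j, 0 <= s 0 j) ->
  2 * dotr a w - dotr (w *m M s) w = dotr w a.
Proof.
move=> s_ge0; rewrite mulmxKV ?reg_gram_unit // (dotrC w a).
by rewrite mulr2n mulrDl !mul1r addrK.
Qed.

Lemma reg_gram_convex s1 s2 t a :
    (forall j, 0 <= s1 0 j) -> (forall j, 0 <= s2 0 j) -> 0 <= t <= 1 ->
  dotr (a *m invmx (M (t *: s1 + (1 - t) *: s2))) a <=
  t * dotr (a *m invmx (M s1)) a + (1 - t) * dotr (a *m invmx (M s2)) a.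
Proof.
move=> s1_ge0 s2_ge0 /andP[t_ge0 t_le1].
have t'_ge0 : 0 <= 1 - t by rewrite subr_ge0.
have s_ge0 j : 0 <= (t *: s1 + (1 - t) *: s2) 0 j.
  by rewrite !mxE addr_ge0 ?mulr_ge0.
(* The maximizer [w] for the mixed point is a competitor for both [s1] and [s2]; since the dual
   objective is affine in [s], the two bounds add up to an identity. *)
rewrite -reg_gram_dual_eq //; set w := a *m _.
have := lerD (ler_wpM2l t_ge0 (reg_gram_dual_le a w s1_ge0))
             (ler_wpM2l t'_ge0 (reg_gram_dual_le a w s2_ge0)).
apply: le_trans; rewrite !reg_gram_form.
rewrite [diag_mx _]linearD /= ![diag_mx (_ *: _)]linearZ /= mulmxDr -!scalemxAr.
by rewrite dotrDl !dotrZl le_eqVlt; apply/orP; left; apply/eqP; ring.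
Qed.

Section Binary.
Variable s : 'rV[R]_p.
Hypothesis s_bin : forall j, s 0 j = 0 \/ s 0 j = 1.

Lemma binary_ge0 j : 0 <= s 0 j.
Proof. by case: (s_bin j) => ->. Qed.

(** This is where the ridge argument needs binary entries and not merely nonnegative ones: it turns
    the form of [diag_mx s] into a squared norm. *)
Lemma diag_binary_idem : diag_mx s *m diag_mx s = diag_mx s.
Proof.
rewrite mulmx_diag; congr diag_mx; apply/rowP => j; rewrite mxE.
by case: (s_bin j) => ->; rewrite ?mulr0 ?mulr1.
Qed.

Lemma reg_gram_form_binary w :
  dotr (w *m M s) w =
  dotr w w + gamma * dotr (w *m G *m diag_mx s) (w *m G *m diag_mx s).
Proof.
rewrite reg_gram_form [in RHS]dotr_mulmxl tr_diag_mx -!mulmxA.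
by rewrite diag_binary_idem !mulmxA [in RHS]dotrC.
Qed.

Lemma ridge_ge a (u : 'rV[R]_p) (r := a - u *m diag_mx s *m G^T) :
  dotr (a *m invmx (M s)) a <= dotr r r + gamma^-1 * dotr u u.
Proof.
have Mu := reg_gram_unit binary_ge0; set w := a *m _.
have wa : dotr w a = dotr r w + dotr u (w *m G *m diag_mx s).
  have -> : a = r + u *m diag_mx s *m G^T by rewrite subrK.
  by rewrite dotrDr dotrC (dotrC w) !dotr_mulmxl tr_diag_mx trmxK.
have wMw : dotr w a = dotr w w + gamma * dotr (w *m G *m diag_mx s) (w *m G *m diag_mx s).
  by rewrite -reg_gram_form_binary mulmxKV // dotrC.
(* Young with constants 1 and [gamma] bounds [2 * dotr w a] by the target plus the right-hand side
   of [wMw], which is [dotr w a] again. *)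
have := dotr_young r w ltr01.
have := dotr_young u (w *m G *m diag_mx s) gamma_gt0.
rewrite invr1 !mul1r; lra.
Qed.

Lemma ridge_eq a (w := a *m invmx (M s)) (u := gamma *: (w *m G *m diag_mx s))
    (r := a - u *m diag_mx s *m G^T) :
  dotr r r + gamma^-1 * dotr u u = dotr w a.
Proof.
have Mu := reg_gram_unit binary_ge0.
(* By idempotency [u S G^T = gamma w G S G^T = w M - w = a - w]. *)
have rw : r = w.
  rewrite /r /u -!scalemxAl -(mulmxA (w *m G)) diag_binary_idem -!mulmxA.
  rewrite -{1}(mulmxKV Mu a) -/w {1}/M /reg_gram mulmxDr mulmx1 -scalemxAr.
  by rewrite !mulmxA addrK.
rewrite rw /u dotrZl (dotrC _ (_ *: _)) dotrZl mulKf ?gt_eqF //.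
by rewrite -reg_gram_form_binary mulmxKV // dotrC.
Qed.

End Binary.

End RidgeDuality.

(** * From single rows to the completion problem *)

Section Completion.
Variables (R : realType) (n m p : nat).
Variables (A : 'M[R]_(n, m)) (Omega : {set 'I_n * 'I_m}).
Variables (B : 'M[R]_(m, p)) (gamma : R).
Hypothesis gamma_gt0 : 0 < gamma.
Implicit Types (s : 'rV[R]_p) (U : 'M[R]_(n, p)).

Let G i := maskW R Omega i *m B.
Let a i := abar A Omega i.

Lemma sum_featK s : \sum_j s 0 j *: featK B j = B *m diag_mx s *m B^T.
Proof.
apply/matrixP => i l; rewrite summxE mul_mx_diag mxE; apply: eq_bigr => j _.
by rewrite !mxE big_ord1 !mxE mulrA (mulrC (B i j)).
Qed.

Lemma cost_mxE s i : cost_mx Omega B gamma s i = reg_gram gamma (G i) s.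
Proof. by rewrite /cost_mx sum_featK /reg_gram trmx_mul tr_diag_mx !mulmxA. Qed.

Lemma cost_dotr s : cost A Omega B gamma s =
  (n * m)%:R^-1 * \sum_i dotr (a i *m invmx (reg_gram gamma (G i) s)) (a i).
Proof. by rewrite /cost; under eq_bigr do rewrite cost_mxE. Qed.

Lemma abarE i j : a i 0 j = if (i, j) \in Omega then A i j else 0.
Proof. by rewrite /a /abar mul_mx_diag !mxE; case: ifP; rewrite ?mulr1 ?mul0r. Qed.

(** Both [a i] and [G i] carry the mask, so the residual [r i] vanishes outside [Omega] and is
    [A - X] on it. *)
Lemma imc_objective_rows U s (r := fun i => a i - row i U *m diag_mx s *m (G i)^T) :
  imc_objective A Omega gamma (U, s, U *m diag_mx s *m B^T) =
  (n * m)%:R^-1 *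
    \sum_i (dotr (r i) (r i) + gamma^-1 * dotr (row i U) (row i U)).
Proof.
rewrite /imc_objective big_split -mulr_sumr /=; congr (_ * (_ + _ * _)).
  transitivity (\sum_i \sum_j if (i, j) \in Omega then
    ((U *m diag_mx s *m B^T) i j - A i j) ^+ 2 else 0).
    by rewrite pair_bigA big_mkcond; apply: eq_bigr => -[].
  apply: eq_bigr => i _; rewrite dotr_sqr; apply: eq_bigr => j _.
  rewrite /r trmx_mul tr_diag_mx mulmxA -!row_mul; move: (U *m _ *m _) => X.
  rewrite [in RHS]mxE abarE mul_mx_diag !mxE.
  by case: ifP => _; rewrite ?mulr1 ?mulr0 ?subrr ?expr0n // -sqrrN opprB.
by apply: eq_bigr => i _; rewrite dotr_sqr; apply: eq_bigr => j _; rewrite mxE.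
Qed.

Lemma cost_le_objective k U s X : imc_feasible B k (U, s, X) ->
  cost A Omega B gamma s <= imc_objective A Omega gamma (U, s, X).
Proof.
(* The prefactor is nonnegative even for [n * m = 0], where the inverse is 0 by convention. *)
case=> -[s_bin _] ->; rewrite cost_dotr imc_objective_rows ler_wpM2l ?invr_ge0 //.
by apply: ler_sum => i _; exact: ridge_ge.
Qed.

Lemma objective_attains_cost k s : binary_vectors k s ->
  exists U X, imc_feasible B k (U, s, X) /\
    imc_objective A Omega gamma (U, s, X) = cost A Omega B gamma s.
Proof.
move=> s_bin.
pose U := \matrix_i (gamma *:
  (a i *m invmx (reg_gram gamma (G i) s) *m G i *m diag_mx s)).
exists U, (U *m diag_mx s *m B^T); split=> //.
rewrite cost_dotr imc_objective_rows; congr (_ * _); apply: eq_bigr => i _.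
by rewrite rowK; apply: ridge_eq => //; case: s_bin.
Qed.

(** By the two preceding lemmas, [cost] at a binary [s] is the minimum of the objective over the
    feasible triples with that [s]; the rest is minimization in two stages. *)
Lemma imc_minimizer_iff k s :
  (exists U X, is_minimizer (imc_feasible B k)
                 (imc_objective A Omega gamma) (U, s, X)) <->
  is_minimizer (binary_vectors k) (cost A Omega B gamma) s.
Proof.
split=> [[U [X [feas minUX]]]|[s_bin min_s]].
  split=> [|s' /objective_attains_cost[U' [X' [feas' <-]]]]; first by case: feas.
  exact: le_trans (cost_le_objective feas) (minUX _ feas').
have [U [X [feas objE]]] := objective_attains_cost s_bin.
exists U, X; split=> // -[[U' s'] X'] feas'; rewrite objE.
by apply: le_trans (cost_le_objective feas'); apply: min_s; case: feas'.
Qed.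

(** The given [U] need not be the explicit ridge solution, so it is compared with that solution at
    the same [s]. *)
Lemma imc_minimizer_objective k U s X :
  is_minimizer (imc_feasible B k) (imc_objective A Omega gamma) (U, s, X) ->
  imc_objective A Omega gamma (U, s, X) = cost A Omega B gamma s.
Proof.
move=> [feas minUX]; have s_bin : binary_vectors k s by case: feas.
apply/le_anti; rewrite (cost_le_objective feas) andbT.
by have [U' [X' [feas' <-]]] := objective_attains_cost s_bin; exact: minUX.
Qed.

Lemma cost_convex : convex_function (@nonneg_orthant R p) (cost A Omega B gamma).
Proof.
move=> t s1 s2 /set_mem s1_ge0 /set_mem s2_ge0; rewrite convRE !cost_dotr.
rewrite !(mulrCA _ (n * m)%:R^-1) -mulrDr ler_wpM2l ?invr_ge0 //.
rewrite !mulr_sumr -big_split /=; apply: ler_sum => i _.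
by apply: reg_gram_convex => //; apply/andP; split.
Qed.

End Completion.

(** * Existence of a minimizer over binary vectors *)

Definition indicator_row (R : realType) (p : nat) (T : {set 'I_p}) : 'rV[R]_p :=
  \row_j (j \in T)%:R.

Lemma indicator_row_binary (R : realType) (p k : nat) (T : {set 'I_p}) :
  binary_vectors k (indicator_row R T) <-> #|T| = k.
Proof.
have sumT : \sum_j indicator_row R T 0 j = #|T|%:R.
  rewrite -sum1_card natr_sum [RHS]big_mkcond; apply: eq_bigr => j _.
  by rewrite mxE; case: (j \in T).
split=> [[_]|<-]; first by rewrite sumT => /eqP; rewrite eqr_nat => /eqP.
by split=> // j; rewrite mxE; case: (j \in T); [right | left].
Qed.

Lemma binary_vector_indicator (R : realType) (p k : nat) (s : 'rV[R]_p) :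
  binary_vectors k s -> s = indicator_row R [set j | s 0 j == 1].
Proof.
move=> [s_bin _]; apply/rowP => j; rewrite mxE inE.
by case: (s_bin j) => ->; rewrite ?eqxx // eq_sym oner_eq0.
Qed.

(** Real rows do not form a finite type, so the minimum is taken over the subsets of ['I_p] of
    cardinality [k], whose indicators are exactly the binary vectors. *)
Lemma binary_minimizer_exists (R : realType) (p k : nat) (f : 'rV[R]_p -> R) :
  (k <= p)%N -> exists s, is_minimizer (binary_vectors k) f s.
Proof.
move=> le_kp.
(* There are ['C(p, k)] such subsets, a positive number as [k <= p]. *)
have /card_gt0P[T0] : (0 < #|[set T : {set 'I_p} | #|T| == k]%SET|)%N.
  by rewrite card_draws card_ord bin_gt0.
rewrite inE => T0k.
have [T /eqP Tk minT] := Order.TotalTheory.arg_minP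
  (P := fun T : {set 'I_p} => #|T| == k) (fun T => f (indicator_row R T)) T0k.
exists (indicator_row R T); split=> [|s s_bin]; first exact/indicator_row_binary.
rewrite (binary_vector_indicator s_bin); apply/minT/eqP.
by apply/(indicator_row_binary R); rewrite -(binary_vector_indicator s_bin).
Qed.

Theorem theorem1 (R : realType) (n m p k : nat)
    (A : 'M[R]_(n, m)) (Omega : {set 'I_n * 'I_m})
    (B : 'M[R]_(m, p)) (gamma : R)
    (hgamma : 0 < gamma) (hk : (1 <= k <= p)%N) :
  [/\ (* both minima are attained and have the same value *)
      exists v : R,
        is_min_value (imc_feasible (n := n) B k)
                     (imc_objective A Omega gamma) v /\
        is_min_value (binary_vectors k) (cost A Omega B gamma) v,
      (* the optimal s coincide *)
      forall s : 'rV[R]_p, binary_vectors k s ->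
        ((exists (U : 'M[R]_(n, p)) (X : 'M[R]_(n, m)),
            is_minimizer (imc_feasible B k)
                         (imc_objective A Omega gamma) (U, s, X)) <->
         is_minimizer (binary_vectors k) (cost A Omega B gamma) s),
      (* the inverses in the formula for c exist on the orthant *)
      forall (s : 'rV[R]_p) (i : 'I_n), nonneg_orthant s ->
        cost_mx Omega B gamma s i \in unitmx
    & convex_function (@nonneg_orthant R p) (cost A Omega B gamma)].
Proof.
have /andP[_ le_kp] := hk.
split.
- have [s min_s] := binary_minimizer_exists (cost A Omega B gamma) le_kp.
  have [U [X min_UX]] := (imc_minimizer_iff A Omega B hgamma k s).2 min_s.
  exists (cost A Omega B gamma s); split; last by exists s.
  by exists (U, s, X) => //; exact: imc_minimizer_objective min_UX.
- by move=> s _; exact: imc_minimizer_iff.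
- by move=> s i s_ge0; rewrite cost_mxE; exact: reg_gram_unit.
- exact: cost_convex.
Qed.
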